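(* Let $r>1$ and let $L=u_t-H(t,x,u_{(r,x)})$ be a differential function of order $r$, where $u_k=\partial^ku/\partial x^k$, $u_{(r,x)}=(u_0,u_1,\dots,u_r)$ with $u_0=u$, and $H_{u_r}\neq0$. A vector field $Q=\tau(t,x,u)\partial_t+\xi(t,x,u)\partial_x+\eta(t,x,u)\partial_u$ with $(\tau,\xi)\neq(0,0)$ is singular for $L$ if and only if $\tau=0$. The co-order of singularity of any singular vector field for any such differential function equals $1$.
   Context: All considerations are local (nonzero functions are considered on domains where they do not vanish); functions are smooth. The independent variables are $t,x$, the dependent variable is $u$; $J^r$ is the jet space of order $r$ and $D_t,D_x$ are the total derivatives. The order of a differential function is the maximal order of derivatives of $u$ it involves. Put $Q[u]=\eta-\tau u_t-\xi u_x$ and $\mathcal Q_{(r)}=\{D_t^aD_x^bQ[u]=0,\ a+b<r\}\subset J^r$. $Q$ is singular for a differential function $L$ of order $r$ if there is a differential function $\tilde L$ of order less than $r$ with $L|_{\mathcal Q_{(r)}}=\tilde L|_{\mathcal Q_{(r)}}$; its singularity co-order (co-order of singularity) is the minimal order of such functions $\tilde L$ (the zero function has order $-1$). *)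

(* Defs.v *)
From HB Require Import structures.
From mathcomp Require Import all_boot all_order all_algebra.
From mathcomp Require Import all_classical all_reals all_analysis.
Import Order.TTheory GRing.Theory Num.Theory numFieldNormedType.Exports.
Set Implicit Arguments.
Unset Strict Implicit.
Unset Printing Implicit Defensive.
Local Open Scope classical_set_scope.
Local Open Scope ring_scope.

(* C^infinity on U, meant for open U: all iterated directional derivatives
   exist and are Frechet differentiable at every point of U. Values outside U
   are irrelevant. *)
Definition smooth (R : realType) (V : normedModType R) (U : set V)
    (f : V -> R) : Prop :=
  forall (vs : seq V) (p : V), U p ->
    differentiable (foldr (fun v g => 'D_v g) f vs) p.

(* The pairs (a, b) with a + b <= n; (a, b) indexes the jet coordinate
   u_{a,b} = d^{a+b} u / dt^a dx^b. *)
Definition mindex (n : nat) : finType :=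
  {c : 'I_n.+1 * 'I_n.+1 | (c.1 + c.2 <= n)%N}.

Definition deg_t n (c : mindex n) : nat := (val c).1.
Definition deg_x n (c : mindex n) : nat := (val c).2.

(* The jet space J^n, with coordinates ((t, x), (u_{a,b})_{a + b <= n}). *)
Notation jet R n := (R * R * 'rV[R]_#|mindex n|)%type.

Section Jets.
Variable R : realType.

Definition tcoord n (p : jet R n) : R := p.1.1.
Definition xcoord n (p : jet R n) : R := p.1.2.

(* The coordinate u_{a,b} of p; the sum has exactly one term if a + b <= n, and
   is empty (hence 0) otherwise. *)
Definition ucoord n (p : jet R n) (a b : nat) : R :=
  \sum_(c : mindex n | (deg_t c == a) && (deg_x c == b)) p.2 0 (enum_rank c).

Definition e_t n : jet R n := (1, 0, 0).
Definition e_x n : jet R n := (0, 1, 0).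
Definition e_u n (c : mindex n) : jet R n := (0, 0, delta_mx 0 (enum_rank c)).

(* The canonical projection J^n -> J^m; only used for m <= n. *)
Definition jproj m n (p : jet R n) : jet R m :=
  (tcoord p, xcoord p,
   \row_i ucoord p (deg_t (enum_val i)) (deg_x (enum_val i))).

Definition base n (p : jet R n) : R * R * R :=
  (tcoord p, xcoord p, ucoord p 0 0).

Definition Dt n (f : jet R n -> R) (p : jet R n.+1) : R :=
  'D_(e_t n) f (jproj n p) +
  \sum_(c : mindex n)
    ucoord p (deg_t c).+1 (deg_x c) * 'D_(e_u c) f (jproj n p).

Definition Dx n (f : jet R n -> R) (p : jet R n.+1) : R :=
  'D_(e_x n) f (jproj n p) +
  \sum_(c : mindex n)
    ucoord p (deg_t c) (deg_x c).+1 * 'D_(e_u c) f (jproj n p).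

Fixpoint iterDt a n (f : jet R n -> R) : jet R (a + n) -> R :=
  match a return jet R (a + n) -> R with
  | 0%N => f
  | a'.+1 => Dt (@iterDt a' n f)
  end.

Fixpoint iterDx b n (f : jet R n -> R) : jet R (b + n) -> R :=
  match b return jet R (b + n) -> R with
  | 0%N => f
  | b'.+1 => Dx (@iterDx b' n f)
  end.

Arguments iterDt a {n} f _.
Arguments iterDx b {n} f _.

(* Q[u] for Q = tau d_t + xi d_x + eta d_u. *)
Definition charac (tau xi eta : R * R * R -> R) (p : jet R 1) : R :=
  eta (base p) - tau (base p) * ucoord p 1 0 - xi (base p) * ucoord p 0 1.

Definition Qmanifold r (tau xi eta : R * R * R -> R) : set (jet R r) :=
  [set p | forall a b, (a + b < r)%N ->
    iterDt a (iterDx b (charac tau xi eta)) (jproj (a + (b + 1)) p) = 0].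

(* The order of f on W: -1 for the zero function; nonzero functions of (t, x)
   alone are given order 0, like nonzero functions of (t, x, u). *)
Definition order n (W : set (jet R n)) (f : jet R n -> R) : int :=
  if `[< forall p, W p -> f p = 0 >] then -1
  else (\max_(c : mindex n | `[< exists2 p, W p & 'D_(e_u c) f p != 0 >])
          (deg_t c + deg_x c)%N)%:Z.

(* L' is a differential function of order less than r, defined on the
   neighbourhood W of p0 in J^r, whose restriction to Q_(r) agrees on W with
   that of L. *)
Definition lower_rep r (tau xi eta : R * R * R -> R) (L : jet R r -> R)
    (p0 : jet R r) (W : set (jet R r)) (L' : jet R r -> R) : Prop :=
  [/\ open_nbhs p0 W, smooth W L', order W L' < r%:Z &
      forall p, W p -> Qmanifold tau xi eta p -> L p = L' p].

(* Singularity and its co-order are local notions: they are stated for germs at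
   a point p0, which is meant to lie on Q_(r) and in the domain of L. *)
Definition singular_at r (tau xi eta : R * R * R -> R) (L : jet R r -> R)
    (p0 : jet R r) : Prop :=
  exists W L', lower_rep tau xi eta L p0 W L'.

Definition coorder_at r (tau xi eta : R * R * R -> R) (L : jet R r -> R)
    (p0 : jet R r) (k : int) : Prop :=
  (exists W L', lower_rep tau xi eta L p0 W L' /\ order W L' = k) /\
  (forall W L', lower_rep tau xi eta L p0 W L' -> k <= order W L').

(* (t, x, u_0, ..., u_r) *)
Definition xjet r (p : jet R r) : R * R * 'rV[R]_r.+1 :=
  (tcoord p, xcoord p, \row_(k < r.+1) ucoord p 0 k).

Definition evol r (H : R * R * 'rV[R]_r.+1 -> R) (p : jet R r) : R :=
  ucoord p 1 0 - H (xjet p).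

Definition e_ur r : R * R * 'rV[R]_r.+1 := (0, 0, delta_mx 0 ord_max).

End Jets.

(* Main.v *)
(* On J^r, the function D_t^a D_x^b Q[u] is affine in the derivatives of order
   a + b + 1, with top part - tau u_{a+1,b} - xi u_{a,b+1}.

   If tau <> 0 at a point of Q_(r), the line through it along which
   u_{a,r-a} moves at speed (- xi / tau)^a stays in Q_(r).  A function of order
   less than r has derivative 0 along it, whereas L = u_t - H has derivative
   - H_{u_r} <> 0 since r > 1; so no representative of lower order exists.

   If xi <> 0, the equations of Q_(r) can be solved successively for the
   u_{a,b+1}, which gives a smooth retraction rho onto Q_(r) that preserves t, x
   and all the u_{a,0}.  It shows that points of Q_(r) project onto a whole
   neighbourhood of the base point, so a singular Q has tau = 0 near the base
   point and not only at it.  When tau = 0 the u_{0,k} are on Q_(r) functions of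
   (t, x, u) only, hence L is there u_t minus a function of (t, x, u), of order 1.
   On the curve s |-> rho (p0 + s e), with e the unit vector of the coordinate
   u_t, this representative has derivative 1, whereas any function of
   order at most 0 has derivative 0. *)

Require Import Defs.
From mathcomp Require Import all_boot all_order all_algebra.
From mathcomp Require Import all_classical all_reals all_analysis.
Import Order.TTheory GRing.Theory Num.Theory numFieldNormedType.Exports.
Set Implicit Arguments.
Unset Strict Implicit.
Unset Printing Implicit Defensive.
Local Open Scope classical_set_scope.
Local Open Scope ring_scope.

(** * Directional derivatives: locality, linearity in the direction, chain rule *)

Section DirectionalDerivatives.
Variables (R : realType) (V V' : normedModType R).

(** Both sides are limits of difference quotients that agree near 0; the case h = 0 gives
    [f p = g q]. The two spaces may differ, so a derivative along a line can be moved to [R] or to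
    another line, without any differentiability. *)
Lemma eq_derive_along (f : V -> R) (g : V' -> R) p q v w :
  (\forall h \near (0 : R), f (h *: v + p) = g (h *: w + q)) ->
  'D_v f p = 'D_w g q.
Proof.
move=> fg; rewrite /derive; congr (lim _).
have fg0 : f p = g q by move: (nbhs_singleton fg); rewrite !scale0r !add0r.
have e : \forall h \near (0 : R),
    h^-1 *: ((f \o shift p) (h *: v) - f p) =
    h^-1 *: ((g \o shift q) (h *: w) - g q).
  by near=> h; rewrite /= fg0; congr (_ *: (_ - _)); near: h.
rewrite eqEsubset; split; apply/near_eq_cvg/cvg_within => //.
by near do apply/esym.
Unshelve. all: by end_near. Qed.

Lemma eq_derive_open (U : set V) (f g : V -> R) p v :
  open U -> U p -> {in U, f =1 g} -> 'D_v f p = 'D_v g p.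
Proof.
move=> oU Up fg; apply: near_eq_derive.
near=> q; apply: fg; apply/mem_set; near: q; exact: open_nbhs_nbhs.
Unshelve. all: by end_near. Qed.

Lemma derive_dirD (g : V -> R) p v w : differentiable g p ->
  'D_(v + w) g p = 'D_v g p + 'D_w g p.
Proof. by move=> dg; rewrite !deriveE // linearD. Qed.

Lemma derive_dirZ (g : V -> R) p k v : differentiable g p ->
  'D_(k *: v) g p = k * 'D_v g p.
Proof. by move=> dg; rewrite !deriveE // linearZ. Qed.

Lemma derive_dir_sum (I : finType) (g : V -> R) p (v : I -> V) :
  differentiable g p -> 'D_(\sum_i v i) g p = \sum_i 'D_(v i) g p.
Proof.
move=> dg; rewrite deriveE // linear_sum.
by apply: eq_bigr => i _; rewrite deriveE.
Qed.

Lemma derive_comp (f : V -> V') (g : V' -> R) p v :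
  differentiable f p -> differentiable g (f p) ->
  'D_v (g \o f) p = 'D_('D_v f p) g (f p).
Proof.
move=> df dg; rewrite !deriveE //; last exact: differentiable_comp.
by rewrite diff_comp //=.
Qed.

Lemma near_line (U : set V) (p v : V) : open U -> U p ->
  \forall h \near (0 : R), U (h *: v + p).
Proof.
move=> oU Up.
have c : {for (0 : R), continuous (fun h : R => h *: v + p)}.
  apply: (@continuousD R V R (fun h : R => h *: v) (fun _ => p)).
    by apply: continuousZl; exact: cvg_id.
  exact: cst_continuous.
apply: c; apply: open_nbhs_nbhs; split=> //.
by rewrite scale0r add0r.
Qed.

End DirectionalDerivatives.

(** * Smooth functions *)

Section SmoothFunctions.
Variable R : realType.

(** A filtration of [smooth] by the number of derivatives. Derivatives of products, inverses and
    composites involve the original functions again, so closure is proved by induction on n rather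
    than on lists of directions. *)
Fixpoint Cn (V : normedModType R) n (U : set V) (f : V -> R) : Prop :=
  (forall p, U p -> differentiable f p) /\
  (if n is m.+1 then forall v, Cn m U ('D_v f) else True).

Lemma smooth_derive (V : normedModType R) (U : set V) (f : V -> R) v :
  smooth U f -> smooth U ('D_v f).
Proof. by move=> sf vs; have := sf (rcons vs v); rewrite foldr_rcons. Qed.

Lemma smooth_differentiable (V : normedModType R) (U : set V) (f : V -> R) p :
  smooth U f -> U p -> differentiable f p.
Proof. by move=> /(_ [::]); apply. Qed.

Lemma smoothP (V : normedModType R) (U : set V) (f : V -> R) :
  smooth U f <-> forall n, Cn n U f.
Proof.
split=> [sf n|].
  elim: n f sf => [|n IH] f sf; split=> //; do ?by apply: (sf [::]).
  by move=> v; apply: IH; exact: smooth_derive.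
move=> Cf vs; elim/last_ind: vs f Cf => [|vs v IH] f Cf p Up.
  by case: (Cf 0%N) => + _; apply.
by rewrite foldr_rcons; apply: IH => // n; case: (Cf n.+1) => _; apply.
Qed.

Section OneSource.
Variable V : normedModType R.
Implicit Types (U : set V) (f g : V -> R).

Lemma Cn_diff n U f p : Cn n U f -> U p -> differentiable f p.
Proof. by case: n => [|n] [+ _]; apply. Qed.

Lemma Cn_derive n U f v : Cn n.+1 U f -> Cn n U ('D_v f).
Proof. by case=> _; apply. Qed.

Lemma CnW n U f : Cn n.+1 U f -> Cn n U f.
Proof.
elim: n f => [|n IH] f [df Df]; split=> // v.
by apply: IH; exact: Df.
Qed.

(** The first-order expansion of f at p is also one of g, and [diff_unique] recognises its linear
    part as the differential of g. *)
Lemma eq_differentiable U f g p : open U -> {in U, f =1 g} -> U p ->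
  differentiable f p -> differentiable g p.
Proof.
move=> oU fg Up df.
have fgp : f p = g p by apply: fg; exact/mem_set.
have cf := diff_continuous df.
have eg : g \o shift p = cst (g p) + 'd f p +o_ (0 : V) id.
  have /eqaddoP ef := diff_locally df.
  apply/eqaddoP => e e0; have := ef e e0.
  have n0 : \forall h \near (0 : V), (f \o shift p) h = (g \o shift p) h.
    have c : {for (0 : V), continuous (shift p)}.
      apply: differentiable_continuous.
      exact: (differentiableD (f := id) (g := cst p)).
    have nU : nbhs (shift p (0 : V)) U by rewrite /= add0r; exact: open_nbhs_nbhs.
    by near=> h; apply: fg; apply/mem_set; near: h; exact: c.
  apply: filterS2 n0 => h; rewrite /= !fctE /= => ->; by rewrite fgp.
apply/diff_locallyP.
by rewrite (diff_unique cf eg).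
Unshelve. all: by end_near. Qed.

Lemma eq_Cn n U f g : open U -> {in U, f =1 g} -> Cn n U f -> Cn n U g.
Proof.
move=> oU; elim: n f g => [|n IH] f g fg Cf; split=> //.
- by move=> p Up; exact: (eq_differentiable oU fg Up (Cn_diff Cf Up)).
- by move=> p Up; exact: (eq_differentiable oU fg Up (Cn_diff Cf Up)).
- move=> v; case: Cf => _ /(_ v); apply: IH => p /set_mem Up.
  exact: eq_derive_open fg.
Qed.

(** Formulas for ['D_v f] are typically valid only on U, so agreement with g is asked only there. *)
Lemma CnS n U f : open U -> (forall p, U p -> differentiable f p) ->
  (forall v, exists2 g, Cn n U g & {in U, g =1 'D_v f}) -> Cn n.+1 U f.
Proof. by move=> oU df Df; split=> // v; have [g Cg e] := Df v; exact: eq_Cn Cg. Qed.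

Lemma Cn_cst n U (k : R) : Cn n U (fun=> k).
Proof.
elim: n k => [|n IH] k; split=> //; do ?by move=> p _; exact: differentiable_cst.
move=> v; suff -> : 'D_v (fun=> k) = fun=> 0 by [].
by apply/funext => p; exact: derive_cst.
Qed.

Lemma CnD n U f g : open U -> Cn n U f -> Cn n U g ->
  Cn n U (fun p => f p + g p).
Proof.
move=> oU; elim: n f g => [|n IH] f g Cf Cg.
  split=> // p Up; apply: differentiableD; [exact: Cn_diff Cf _|exact: Cn_diff Cg _].
apply: CnS => // [p Up|v].
  by apply: differentiableD; [exact: Cn_diff Cf _|exact: Cn_diff Cg _].
exists (fun p => 'D_v f p + 'D_v g p).
  by apply: IH; exact: Cn_derive.
move=> p /set_mem Up.
by rewrite deriveD//; apply: diff_derivable; [exact: Cn_diff Cf _|exact: Cn_diff Cg _].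
Qed.

Lemma CnM n U f g : open U -> Cn n U f -> Cn n U g ->
  Cn n U (fun p => f p * g p).
Proof.
move=> oU; elim: n f g => [|n IH] f g Cf Cg.
  split=> // p Up; apply: differentiableM; [exact: Cn_diff Cf _|exact: Cn_diff Cg _].
apply: CnS => // [p Up|v].
  by apply: differentiableM; [exact: Cn_diff Cf _|exact: Cn_diff Cg _].
exists (fun p => f p * 'D_v g p + g p * 'D_v f p).
  by apply: CnD => //; apply: IH; do ?[exact: CnW|exact: Cn_derive].
move=> p /set_mem Up.
by rewrite deriveM//; apply: diff_derivable; [exact: Cn_diff Cf _|exact: Cn_diff Cg _].
Qed.

Lemma CnV n U f : open U -> (forall p, U p -> f p != 0) -> Cn n U f ->
  Cn n U (fun p => (f p)^-1).
Proof.
move=> oU f0; elim: n => [|n IH] Cf.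
  by split=> // p Up; apply: differentiableV; [exact: Cn_diff Cf _|exact: f0].
apply: CnS => // [p Up|v].
  by apply: differentiableV; [exact: Cn_diff Cf _|exact: f0].
(* The derivative - f^-2 D_v f contains f^-1 itself, which the induction hypothesis controls one
   level lower. *)
have CfV := IH (CnW Cf).
exists (fun p => -1 * ((f p)^-1 * (f p)^-1) * 'D_v f p).
  by apply: CnM => //; [apply: CnM => //; [exact: Cn_cst|exact: CnM]|exact: Cn_derive].
move=> p /set_mem Up.
rewrite deriveV ?f0 //; last by apply: diff_derivable; exact: Cn_diff Cf _.
by rewrite expr2 invfM mulN1r.
Qed.

Lemma smooth_subset U U' f : U `<=` U' -> smooth U' f -> smooth U f.
Proof. by move=> UU' sf vs p /UU'; exact: sf. Qed.

Lemma smooth_cst U (k : R) : smooth U (fun=> k).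
Proof. by apply/smoothP => n; exact: Cn_cst. Qed.

Lemma smoothD U f g : open U -> smooth U f -> smooth U g ->
  smooth U (fun p => f p + g p).
Proof. by move=> oU /smoothP Cf /smoothP Cg; apply/smoothP => n; exact: CnD. Qed.

Lemma smoothM U f g : open U -> smooth U f -> smooth U g ->
  smooth U (fun p => f p * g p).
Proof. by move=> oU /smoothP Cf /smoothP Cg; apply/smoothP => n; exact: CnM. Qed.

Lemma smoothB U f g : open U -> smooth U f -> smooth U g ->
  smooth U (fun p => f p - g p).
Proof.
move=> oU sf sg; have -> : (fun p => f p - g p) = (fun p => f p + (-1) * g p).
  by apply/funext => p; rewrite mulN1r.
by apply: smoothD => //; apply: smoothM => //; exact: smooth_cst.
Qed.

Lemma smoothV U f : open U -> (forall p, U p -> f p != 0) -> smooth U f ->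
  smooth U (fun p => (f p)^-1).
Proof. by move=> oU f0 /smoothP Cf; apply/smoothP => n; exact: CnV. Qed.

Lemma smooth_sum (I : finType) U (F : I -> V -> R) : open U ->
  (forall i, smooth U (F i)) -> smooth U (fun p => \sum_i F i p).
Proof.
move=> oU sF; elim: (index_enum I) => [|i s IH].
  by under eq_fun do rewrite big_nil; exact: smooth_cst.
by under eq_fun do rewrite big_cons; exact: smoothD.
Qed.

Lemma derive_affine (f : V -> R) v p k :
  (forall h, f (h *: v + p) = f p + h * k) -> 'D_v f p = k.
Proof.
move=> fk; have <- : 'D_1 (fun h : R => h * k + f p) 0 = k.
  have -> : (fun h : R => h * k + f p) = (fun h : R => k *: h) + cst (f p).
    by apply/funext => h; rewrite !fctE /= [in RHS]/GRing.scale /= mulrC.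
  rewrite deriveD; last 2 first.
  - by apply: derivableZ; exact: derivable_id.
  - exact: derivable_cst.
  rewrite derive_cst addr0 deriveZ /= ?derive_id; first by rewrite /GRing.scale /= mulr1.
  exact: derivable_id.
apply: eq_derive_along; near=> h.
by rewrite fk addr0 [in RHS]/GRing.scale /= mulr1 addrC.
Unshelve. all: by end_near. Qed.

Lemma derive_linear (l : V -> R) v p : linear l -> 'D_v l p = l v.
Proof. by move=> ll; apply: derive_affine => h; rewrite ll addrC. Qed.

(** Each directional derivative is constant. Differentiability is a separate hypothesis because a
    linear function on a normed space need not be continuous. *)
Lemma smooth_linear U (l : V -> R) : linear l ->
  (forall p, differentiable l p) -> smooth U l.
Proof.
move=> ll dl; apply/smoothP => -[|n]; split=> // v.
have -> : 'D_v l = fun=> l v by apply/funext => p; exact: derive_linear.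
exact: Cn_cst.
Qed.

End OneSource.

(** * Composition with smooth maps *)

Section Composition.
Variables (V V' : normedModType R).

(* Finite combinations of fixed vectors with smooth coefficients: the chain rule
   for g \o phi is then a finite sum of products of smooth functions, and
   smoothness of g \o phi follows by induction. *)
Inductive smooth_map (U : set V) : (V -> V') -> Prop :=
| smooth_map0 : smooth_map U (fun=> 0)
| smooth_mapDZ phi f v : smooth_map U phi -> smooth U f ->
    smooth_map U (fun p => phi p + f p *: v).

Lemma smooth_map_subset U W phi : U `<=` W -> smooth_map W phi -> smooth_map U phi.
Proof.
move=> UW; elim=> [|psi f v _ sp sf]; first exact: smooth_map0.
by apply: smooth_mapDZ => //; exact: smooth_subset sf.
Qed.

Lemma smooth_map_differentiable U phi p : smooth_map U phi -> U p ->
  differentiable phi p.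
Proof.
move=> sp Up; elim: sp => [|psi f v _ dp sf]; first exact: differentiable_cst.
apply: (@differentiableD _ _ _ psi (fun p => f p *: v)) => //.
by apply: differentiableZl; exact: smooth_differentiable sf _.
Qed.

Lemma smooth_map_continuous U phi p : smooth_map U phi -> U p ->
  {for p, continuous phi}.
Proof.
by move=> sp Up; apply: differentiable_continuous; exact: smooth_map_differentiable sp Up.
Qed.

Lemma smooth_mapD U phi psi : smooth_map U phi -> smooth_map U psi ->
  smooth_map U (fun p => phi p + psi p).
Proof.
move=> sphi; elim=> [|chi f v _ sp sf].
  by under eq_fun do rewrite addr0.
by under eq_fun do rewrite addrA; exact: smooth_mapDZ.
Qed.

Lemma smooth_mapZ U f v : smooth U f -> smooth_map U (fun p => f p *: v).
Proof.
move=> sf; under eq_fun do rewrite -[_ *: _]add0r.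
by apply: smooth_mapDZ => //; exact: smooth_map0.
Qed.

Lemma smooth_map_sum (I : finType) U (F : I -> V -> V') :
  (forall i, smooth_map U (F i)) -> smooth_map U (fun p => \sum_i F i p).
Proof.
move=> sF; elim: (index_enum I) => [|i s IH].
  by under eq_fun do rewrite big_nil; exact: smooth_map0.
by under eq_fun do rewrite big_cons; exact: smooth_mapD.
Qed.

Lemma smooth_comp U U' (phi : V -> V') (g : V' -> R) : open U ->
  (forall p, U p -> U' (phi p)) -> smooth_map U phi -> smooth U' g ->
  smooth U (fun p => g (phi p)).
Proof.
move=> oU UU' sphi sg; apply/smoothP => n.
elim: n g sg => [|n IH] g sg.
  split=> // p Up; apply: differentiable_comp.
    exact: smooth_map_differentiable sphi _.
  by apply: smooth_differentiable sg _; exact: UU'.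
have dphi p : U p -> differentiable phi p by exact: smooth_map_differentiable.
have dg p : U p -> differentiable g (phi p).
  by move=> Up; apply: smooth_differentiable sg _; exact: UU'.
apply: CnS => // [p Up|v]; first by apply: differentiable_comp; auto.
(* The direction ['D_v phi p] varies with p. Taking it from an arbitrary psi while keeping the point
   [phi p] allows induction on psi: only fixed vectors w remain, and the outer induction applies to
   ['D_w g]. *)
suff : forall psi, smooth_map U psi -> exists2 h, Cn n U h &
    {in U, h =1 fun p => 'D_('D_v psi p) g (phi p)}.
  move=> /(_ _ sphi)[h Ch e]; exists h => // p Up; rewrite e //.
  by move/set_mem in Up; rewrite -derive_comp//; auto.
move=> psi; elim=> [|chi f w schi [h Ch e] sf].
  exists (fun=> 0); first exact: Cn_cst.
  by move=> p _; rewrite derive_cst derive0.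
exists (fun p => h p + 'D_v f p * 'D_w g (phi p)).
  apply: CnD => //; apply: CnM => //.
    by apply: Cn_derive; move/smoothP: sf; apply.
  by apply: (IH ('D_w g)); exact: smooth_derive.
move=> p /[dup] pU /set_mem Up; rewrite e //.
have df := smooth_differentiable sf Up.
have -> : 'D_v (fun p => chi p + f p *: w) p = 'D_v chi p + 'D_v f p *: w.
  rewrite (@deriveD _ _ _ chi (fun p => f p *: w)); last 2 first.
  - by apply: diff_derivable; exact: smooth_map_differentiable schi _.
  - by apply: diff_derivable; exact: differentiableZl.
  congr (_ + _); rewrite !deriveE//; last exact: differentiableZl.
  by rewrite diffZl.
by rewrite derive_dirD ?derive_dirZ //; exact: dg.
Qed.

End Composition.

End SmoothFunctions.

(** * Jet coordinates *)

Section JetCoordinates.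
Variable R : realType.

Lemma mindex_deg n (c : mindex n) : (deg_t c + deg_x c <= n)%N.
Proof. exact: valP c. Qed.

Lemma mindex_of_subproof n a b : (a + b <= n)%N ->
  ((inord a : 'I_n.+1) + (inord b : 'I_n.+1) <= n)%N.
Proof.
move=> abn; rewrite !inordK ?ltnS//.
  exact: leq_trans (leq_addl _ _) abn.
exact: leq_trans (leq_addr _ _) abn.
Qed.

Definition mindex_of n a b (abn : (a + b <= n)%N) : mindex n :=
  exist (fun c : 'I_n.+1 * 'I_n.+1 => (c.1 + c.2 <= n)%N) (inord a, inord b)
    (mindex_of_subproof abn).

Lemma deg_t_mindex_of n a b (abn : (a + b <= n)%N) : deg_t (mindex_of abn) = a.
Proof. by rewrite /deg_t /= inordK // ltnS; exact: leq_trans (leq_addr _ _) abn. Qed.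

Lemma deg_x_mindex_of n a b (abn : (a + b <= n)%N) : deg_x (mindex_of abn) = b.
Proof. by rewrite /deg_x /= inordK // ltnS; exact: leq_trans (leq_addl _ _) abn. Qed.

Lemma ucoord_coef n (p : jet R n) (c : mindex n) :
  ucoord p (deg_t c) (deg_x c) = p.2 0 (enum_rank c).
Proof.
by rewrite /ucoord (big_pred1 c).
Qed.

Lemma ucoord_mindex_of n (p : jet R n) a b (abn : (a + b <= n)%N) :
  ucoord p a b = p.2 0 (enum_rank (mindex_of abn)).
Proof. by rewrite -ucoord_coef deg_t_mindex_of deg_x_mindex_of. Qed.

Lemma ucoord_out n (p : jet R n) a b : (n < a + b)%N -> ucoord p a b = 0.
Proof.
move=> nab; rewrite /ucoord big_pred0 // => c.
apply/negP => /andP[/eqP ea /eqP eb].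
by have := mindex_deg c; rewrite ea eb leqNgt nab.
Qed.

Lemma ucoord_linear n a b : linear (fun p : jet R n => ucoord p a b).
Proof.
move=> k p q; have [abn|nab] := leqP (a + b) n; last first.
  by rewrite !ucoord_out // scaler0 addr0.
by rewrite !(ucoord_mindex_of _ abn) !mxE.
Qed.

Lemma ucoordD n (p q : jet R n) a b : ucoord (p + q) a b = ucoord p a b + ucoord q a b.
Proof. by have := @ucoord_linear n a b 1 p q; rewrite !scale1r. Qed.

Lemma ucoordZ n k (p : jet R n) a b : ucoord (k *: p) a b = k * ucoord p a b.
Proof.
have := @ucoord_linear n a b k p 0; rewrite addr0 => ->.
suff -> : ucoord (0 : jet R n) a b = 0 by rewrite addr0.
by have := ucoordD (0 : jet R n) 0 a b; rewrite addr0 => /eqP; rewrite -subr_eq subrr => /eqP.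
Qed.

Lemma ucoordN n (p : jet R n) a b : ucoord (- p) a b = - ucoord p a b.
Proof. by rewrite -scaleN1r ucoordZ mulN1r. Qed.

Lemma ucoord0 n a b : ucoord (0 : jet R n) a b = 0.
Proof. by rewrite -(scale0r (0 : jet R n)) ucoordZ mul0r. Qed.

Lemma jet_ext n (p q : jet R n) : tcoord p = tcoord q -> xcoord p = xcoord q ->
  (forall a b, (a + b <= n)%N -> ucoord p a b = ucoord q a b) -> p = q.
Proof.
case: p q => [[t x] w] [[t' x'] w']; rewrite /tcoord /xcoord /= => -> -> u.
congr (_, _); apply/rowP => i; rewrite -[i]enum_valK.
by have := u _ _ (mindex_deg (enum_val i)); rewrite !ucoord_coef.
Qed.

Definition mkjet n (t x : R) (w : nat -> nat -> R) : jet R n :=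
  (t, x, \row_i w (deg_t (enum_val i)) (deg_x (enum_val i))).

Lemma ucoord_mkjet n t x w a b : (a + b <= n)%N -> ucoord (mkjet n t x w) a b = w a b.
Proof.
move=> abn; rewrite (ucoord_mindex_of _ abn) /= mxE enum_rankK.
by rewrite deg_t_mindex_of deg_x_mindex_of.
Qed.

Lemma jprojE m n (p : jet R n) : jproj m p = mkjet m (tcoord p) (xcoord p) (ucoord p).
Proof. by []. Qed.

Lemma ucoord_jproj m n (p : jet R n) a b : (a + b <= m)%N ->
  ucoord (jproj m p) a b = ucoord p a b.
Proof. exact: ucoord_mkjet. Qed.

Lemma base_jproj m n (p : jet R n) : base (jproj m p) = base p.
Proof. by rewrite /base ucoord_jproj. Qed.

Lemma jproj_jproj k m n (p : jet R n) : (k <= m)%N -> jproj k (jproj m p) = jproj k p.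
Proof.
move=> km; apply: jet_ext => // a b abk.
by rewrite !ucoord_jproj // (leq_trans abk).
Qed.

Lemma jproj_linear m n : linear (fun p : jet R n => jproj m p).
Proof.
move=> k p q; apply: jet_ext => // a b abk.
by rewrite ucoordD ucoordZ !ucoord_jproj // ucoordD ucoordZ.
Qed.

Lemma jprojD m n (p q : jet R n) : jproj m (p + q) = jproj m p + jproj m q.
Proof. by have := @jproj_linear m n 1 p q; rewrite !scale1r. Qed.

Lemma jproj0 m n : jproj m (0 : jet R n) = 0.
Proof. by apply: jet_ext => // a b ab; rewrite ucoord_jproj // !ucoord0. Qed.

Lemma jprojZ m n k (p : jet R n) : jproj m (k *: p) = k *: jproj m p.
Proof. by have := @jproj_linear m n k p 0; rewrite jproj0 !addr0. Qed.

Lemma jproj_eq0 m n (p : jet R n) : tcoord p = 0 -> xcoord p = 0 ->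
  (forall a b, (a + b <= m)%N -> ucoord p a b = 0) -> jproj m p = 0.
Proof.
move=> t0 x0 u0; apply: jet_ext => // a b abm.
by rewrite ucoord_jproj // u0 // ucoord0.
Qed.

Lemma jproj0P m n (p : jet R n) : jproj m p = 0 ->
  [/\ tcoord p = 0, xcoord p = 0 &
      forall a b, (a + b <= m)%N -> ucoord p a b = 0].
Proof.
move=> p0; split.
- by rewrite -[tcoord p]/(tcoord (jproj m p)) p0.
- by rewrite -[xcoord p]/(xcoord (jproj m p)) p0.
- by move=> a b abm; rewrite -(ucoord_jproj p abm) p0 ucoord0.
Qed.

Lemma baseD n (p q : jet R n) : base (p + q) = base p + base q.
Proof. by rewrite /base ucoordD. Qed.

Lemma baseZ n k (p : jet R n) : base (k *: p) = k *: base p.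
Proof. by rewrite /base ucoordZ. Qed.

(** Serves twice: a derivative along any vector becomes a sum over coordinates, and a map into a jet
    space is smooth as soon as its coordinates are. *)
Lemma jet_decomp n (p : jet R n) : p = tcoord p *: e_t R n + xcoord p *: e_x R n +
  \sum_(c : mindex n) ucoord p (deg_t c) (deg_x c) *: e_u R c.
Proof.
have e2 : (\sum_(c : mindex n) ucoord p (deg_t c) (deg_x c) *: e_u R c).2 =
    \sum_(c : mindex n) ucoord p (deg_t c) (deg_x c) *: delta_mx 0 (enum_rank c).
  by rewrite raddf_sum.
have e1 : (\sum_(c : mindex n) ucoord p (deg_t c) (deg_x c) *: e_u R c).1 = 0.
  by rewrite raddf_sum big1 // => c _ /=; apply/pair_equal_spec; rewrite /GRing.scale /= !mulr0.
rewrite [X in _ = _ + X]surjective_pairing e1 e2.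
case: p {e1 e2} => [[t x] w]; rewrite /tcoord /xcoord /=.
congr (_, _, _) => /=.
- by rewrite /GRing.scale /= mulr1 mulr0 !addr0.
- by rewrite /GRing.scale /= mulr1 mulr0 add0r addr0.
rewrite !scaler0 !add0r; apply/rowP => i; rewrite summxE (bigD1 (enum_val i)) //=.
rewrite ucoord_coef enum_valK !mxE !eqxx mulr1 big1 ?addr0 // => c ci.
rewrite !mxE eqxx /= (_ : i == enum_rank c = false) ?mulr0 //.
by apply/negbTE/negP => /eqP ic; move: ci; rewrite ic enum_rankK eqxx.
Qed.

Lemma smooth_tcoord n (U : set (jet R n)) : smooth U (@tcoord R n).
Proof.
apply: smooth_linear => [k p q //|p].
apply: (differentiable_comp (f := fst) (g := fst)).
  apply: linear_differentiable => q; exact: cvg_fst.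
apply: linear_differentiable => q; exact: cvg_fst.
Qed.

Lemma smooth_xcoord n (U : set (jet R n)) : smooth U (@xcoord R n).
Proof.
apply: smooth_linear => [k p q //|p].
apply: (differentiable_comp (f := fst) (g := snd)).
  apply: linear_differentiable => q; exact: cvg_fst.
apply: linear_differentiable => q; exact: cvg_snd.
Qed.

Lemma smooth_ucoord n (U : set (jet R n)) a b : smooth U (fun p => ucoord p a b).
Proof.
have [abn|nab] := leqP (a + b) n; last first.
  by under eq_fun do rewrite ucoord_out //; exact: smooth_cst.
apply: smooth_linear => [|p]; first exact: ucoord_linear.
under eq_fun do rewrite (ucoord_mindex_of _ abn).
apply: (differentiable_comp (f := snd)
    (g := fun N : 'rV[R]_#|mindex n| => N 0 (enum_rank (mindex_of abn)))).
  apply: linear_differentiable => q; exact: cvg_snd.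
exact: differentiable_coord.
Qed.

Lemma smooth_map_jet n (V : normedModType R) (U : set V) (phi : V -> jet R n) :
  smooth U (fun p => tcoord (phi p)) -> smooth U (fun p => xcoord (phi p)) ->
  (forall a b, smooth U (fun p => ucoord (phi p) a b)) -> smooth_map U phi.
Proof.
move=> st sx su.
rewrite (_ : phi = fun p => tcoord (phi p) *: e_t R n + xcoord (phi p) *: e_x R n +
    \sum_(c : mindex n) ucoord (phi p) (deg_t c) (deg_x c) *: e_u R c); last first.
  by apply/funext => p; exact: jet_decomp.
apply: smooth_mapD; first by apply: smooth_mapD; exact: smooth_mapZ.
by apply: smooth_map_sum => c; exact: smooth_mapZ.
Qed.

Lemma smooth_map_id n (U : set (jet R n)) : smooth_map U id.
Proof.
apply: smooth_map_jet; [exact: smooth_tcoord|exact: smooth_xcoord|].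
by move=> a b; exact: smooth_ucoord.
Qed.

Lemma smooth_map_jproj m n (U : set (jet R n)) : smooth_map U (@jproj R m n).
Proof.
apply: smooth_map_jet; [exact: smooth_tcoord|exact: smooth_xcoord|].
move=> a b; have [abm|mab] := leqP (a + b) m.
  by under eq_fun do rewrite ucoord_jproj //; exact: smooth_ucoord.
by under eq_fun do rewrite ucoord_out //; exact: smooth_cst.
Qed.

Lemma smooth_map_base n (U : set (jet R n)) : smooth_map U (@base R n).
Proof.
rewrite (_ : @base R n = fun p => tcoord p *: (1, 0, 0) + xcoord p *: (0, 1, 0) +
    ucoord p 0 0 *: (0, 0, 1)); last first.
  apply/funext => p; rewrite /base; congr (_, _, _);
    by rewrite /= /GRing.scale /= !(mulr0, mulr1, addr0, add0r).
apply: smooth_mapD; first apply: smooth_mapD; apply: smooth_mapZ.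
- exact: smooth_tcoord.
- exact: smooth_xcoord.
- exact: smooth_ucoord.
Qed.

Lemma smooth_map_xjet n (U : set (jet R n)) : smooth_map U (@xjet R n).
Proof.
rewrite (_ : @xjet R n = fun p => tcoord p *: (1, 0, 0) + xcoord p *: (0, 1, 0) +
    \sum_(k < n.+1) ucoord p 0 k *: (0, 0, delta_mx 0 k)); last first.
  apply/funext => p.
  have e2 : (\sum_(k < n.+1) ucoord p 0 k *: (0 : R, 0 : R, delta_mx 0 k : 'rV[R]_n.+1)).2
      = \sum_(k < n.+1) ucoord p 0 k *: delta_mx 0 k by rewrite raddf_sum.
  have e1 : (\sum_(k < n.+1) ucoord p 0 k *: (0 : R, 0 : R, delta_mx 0 k : 'rV[R]_n.+1)).1 = 0.
    by rewrite raddf_sum big1 // => k _ /=; apply/pair_equal_spec; rewrite /GRing.scale /= !mulr0.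
  rewrite [X in _ = _ + X]surjective_pairing e1 e2 /xjet.
  congr (_, _, _) => /=.
  - by rewrite /GRing.scale /= mulr1 mulr0 !addr0.
  - by rewrite /GRing.scale /= mulr1 mulr0 add0r addr0.
  rewrite !scaler0 !add0r [LHS]row_sum_delta.
  by apply: eq_bigr => k _; rewrite mxE.
apply: smooth_mapD; first by apply: smooth_mapD; apply: smooth_mapZ;
  [exact: smooth_tcoord|exact: smooth_xcoord].
by apply: smooth_map_sum => k; apply: smooth_mapZ; exact: smooth_ucoord.
Qed.

End JetCoordinates.

(** * Total derivatives of the characteristic *)

Section TotalDerivatives.
Variable R : realType.
Implicit Types V : set (R * R * R).

Definition over V n : set (jet R n) := [set p | V (base p)].

Arguments over : clear implicits.

Lemma open_over V n : open V -> open (@over V n).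
Proof.
move=> oV; apply: (open_comp (f := @base R n)) => // p _.
exact: smooth_map_continuous (smooth_map_base setT) _.
Qed.

Lemma smooth_over V n (f : R * R * R -> R) : open V -> smooth V f ->
  smooth (over V n) (fun p => f (base p)).
Proof.
move=> oV sf; apply: smooth_comp sf; [exact: open_over|by []|exact: smooth_map_base].
Qed.

(** The linear part of [tvec i j] below; its t and x entries are 0 because those of [tvec] are
    constant. *)
Definition ushift n i j (v : jet R n.+1) : jet R n :=
  mkjet n 0 0 (fun a b => ucoord v (i + a) (j + b)).

(* D_t f and D_x f at p are the derivatives of f at jproj n p along tvec 1 0 p and
   tvec 0 1 p; this replaces product rules by linearity in the direction. *)
Definition tvec n i j (p : jet R n.+1) : jet R n :=
  mkjet n i%:R j%:R (fun a b => ucoord p (i + a) (j + b)).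

Lemma tvecD n i j (p v : jet R n.+1) : tvec i j (p + v) = tvec i j p + ushift i j v.
Proof.
apply: jet_ext => [||a b ab].
- by rewrite /tcoord /= addr0.
- by rewrite /xcoord /= addr0.
- by rewrite ucoordD !ucoord_mkjet // ucoordD.
Qed.

Lemma derive_tvec n (f : jet R n -> R) i j (p : jet R n.+1) :
  differentiable f (jproj n p) ->
  'D_(tvec i j p) f (jproj n p) =
  i%:R * 'D_(e_t R n) f (jproj n p) + j%:R * 'D_(e_x R n) f (jproj n p) +
  \sum_(c : mindex n)
    ucoord p (i + deg_t c) (j + deg_x c) * 'D_(e_u R c) f (jproj n p).
Proof.
move=> df; rewrite [X in 'D_X _ _]jet_decomp derive_dirD // derive_dirD // !derive_dirZ //.
congr (_ + _); rewrite derive_dir_sum //; apply: eq_bigr => c _.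
by rewrite derive_dirZ // ucoord_mkjet // mindex_deg.
Qed.

Lemma Dt_tvec n (f : jet R n -> R) (p : jet R n.+1) :
  differentiable f (jproj n p) -> Dt f p = 'D_(tvec 1 0 p) f (jproj n p).
Proof. by move=> df; rewrite derive_tvec // mul1r mul0r addr0. Qed.

Lemma Dx_tvec n (f : jet R n -> R) (p : jet R n.+1) :
  differentiable f (jproj n p) -> Dx f p = 'D_(tvec 0 1 p) f (jproj n p).
Proof. by move=> df; rewrite derive_tvec // mul1r mul0r add0r. Qed.

Lemma smooth_Dt V n (f : jet R n -> R) : open V ->
  smooth (over V n) f -> smooth (over V n.+1) (Dt f).
Proof.
move=> oV sf; have oU := @open_over V n.+1 oV.
have sD v : smooth (over V n.+1) (fun p => 'D_v f (jproj n p)).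
  apply: (smooth_comp (U' := over V n)) (smooth_map_jproj n _) (smooth_derive _ sf) => //.
  by move=> p; rewrite /over /= base_jproj.
apply: smoothD => //; apply: smooth_sum => // c.
by apply: smoothM => //; exact: smooth_ucoord.
Qed.

Lemma smooth_Dx V n (f : jet R n -> R) : open V ->
  smooth (over V n) f -> smooth (over V n.+1) (Dx f).
Proof.
move=> oV sf; have oU := @open_over V n.+1 oV.
have sD v : smooth (over V n.+1) (fun p => 'D_v f (jproj n p)).
  apply: (smooth_comp (U' := over V n)) (smooth_map_jproj n _) (smooth_derive _ sf) => //.
  by move=> p; rewrite /over /= base_jproj.
apply: smoothD => //; apply: smooth_sum => // c.
by apply: smoothM => //; exact: smooth_ucoord.
Qed.

(** * Dependence of D_t^a D_x^b Q[u] on the jet coordinates *)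

Section Characteristic.
Variables (V : set (R * R * R)) (tau xi eta : R * R * R -> R).
Hypotheses (oV : open V) (stau : smooth V tau) (sxi : smooth V xi)
  (seta : smooth V eta).

(** Stated by finite translations rather than derivatives, so that lines in Q_(r) and exact
    solutions can be read off. When n = a + b + 1, the vector v moves only derivatives of order
    n. *)
Definition top_affine n (f : jet R n -> R) a b := forall p v, V (base p) ->
  jproj (a + b) v = 0 ->
  f (p + v) = f p - tau (base p) * ucoord v a.+1 b - xi (base p) * ucoord v a b.+1.

(** Translation by v leaves the point [jproj n p] fixed and adds [ushift i j v] to the direction.
    The added vector has only components of order n, so f is affine along it, with slope given by
    [top_affine f a b]. The pairs (1, 0) and (0, 1) for (i, j) cover D_t and D_x. *)
Lemma top_affine_tvec n (f : jet R n -> R) a b i j : n = (a + b).+1 ->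
  (i + j = 1)%N -> smooth (over V n) f -> top_affine f a b ->
  top_affine (fun p : jet R n.+1 => 'D_(tvec i j p) f (jproj n p)) (i + a) (j + b).
Proof.
move=> En ij1 sf fa p v Vp v0.
have Enij : (i + a + (j + b) = n)%N by rewrite En addnACA ij1 add1n.
rewrite Enij in v0; have [t0 x0 u0] := jproj0P v0.
have Vq : V (base (jproj n p)) by rewrite base_jproj.
rewrite jprojD v0 addr0 tvecD derive_dirD; last exact: smooth_differentiable sf _.
rewrite -!addrA; congr (_ + _).
have iaS : (i + a.+1 + (j + b) = n.+1)%N by rewrite addnS addSn Enij.
have w0 : jproj (a + b) (ushift i j v) = 0.
  apply: jproj_eq0 => // a' b' ab'.
  have abn : (a' + b' <= n)%N by rewrite En (leq_trans ab').
  rewrite ucoord_mkjet // u0 // addnACA ij1 add1n En ltnS //.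
apply: derive_affine => h.
rewrite [h *: _ + _]addrC fa ?jprojZ ?w0 ?scaler0 //.
rewrite !ucoordZ !ucoord_mkjet ?En ?addnS ?addSn // base_jproj.
by rewrite !(mulrCA _ h) -addrA -!mulrN -mulrDr !mulrN.
Qed.

Notation Qu := (charac tau xi eta).
Notation iterDxQ b := (@iterDx R b 1 Qu).
Notation iterDtx a b := (@iterDt R a (b + 1) (iterDxQ b)).

Lemma smooth_charac : smooth (over V 1) Qu.
Proof.
have oU := @open_over V 1 oV.
by apply: smoothB => //; first apply: smoothB => //;
  do ?apply: smoothM => //; do ?[exact: smooth_over|exact: smooth_ucoord].
Qed.

Lemma smooth_iterDx b : smooth (over V (b + 1)) (iterDxQ b).
Proof. by elim: b => [|b IH]; [exact: smooth_charac|exact: smooth_Dx]. Qed.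

Lemma smooth_iterD a b : smooth (over V (a + (b + 1))) (iterDtx a b).
Proof. by elim: a => [|a IH]; [exact: smooth_iterDx|exact: smooth_Dt]. Qed.

Lemma top_affine_charac : top_affine Qu 0 0.
Proof.
move=> p v Vp /jproj0P[t0 x0 u0].
have bv : base (p + v) = base p by rewrite baseD /base t0 x0 u0 // addr0.
rewrite /charac bv !ucoordD !mulrDr !opprD !addrA; congr (_ + _).
by rewrite -!addrA; congr (_ + (_ + _)); rewrite addrC.
Qed.

(** Needed because [Dt_tvec] and [Dx_tvec] are available only over V, where differentiability is
    known. A translation with vanishing projection keeps the base point, hence stays over V. *)
Lemma eq_top_affine n (f g : jet R n -> R) a b :
  {in over V n, f =1 g} -> top_affine f a b -> top_affine g a b.
Proof.
move=> fg fa p v Vp v0; have [t0 x0 u0] := jproj0P v0.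
have bv : base (p + v) = base p by rewrite baseD /base t0 x0 u0 // addr0.
by rewrite -!fg ?fa //; apply/mem_set; rewrite /over /= ?bv.
Qed.

Lemma top_affine_iterDx b : top_affine (iterDxQ b) 0 b.
Proof.
elim: b => [|b IH]; first exact: top_affine_charac.
have sf := @smooth_iterDx b.
apply: eq_top_affine (top_affine_tvec (i := 0) (j := 1) _ _ sf IH) => //.
- move=> p /set_mem Vp /=; rewrite -Dx_tvec //.
  by apply: smooth_differentiable sf _; rewrite /over /= base_jproj.
- by rewrite addn1.
Qed.

Lemma top_affine_iterD a b : top_affine (iterDtx a b) a b.
Proof.
elim: a => [|a IH]; first exact: top_affine_iterDx.
have sf := @smooth_iterD a b.
apply: eq_top_affine (top_affine_tvec (i := 1) (j := 0) _ _ sf IH) => //.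
- move=> p /set_mem Vp /=; rewrite -Dt_tvec //.
  by apply: smooth_differentiable sf _; rewrite /over /= base_jproj.
- by rewrite addn1 addnS.
Qed.

(** Convertible to the left sides of the equations in [Qmanifold]. For a + b >= r, the coordinates
    missing in J^r would be read as 0. *)
Definition DQ r a b (p : jet R r) : R :=
  iterDtx a b (jproj (a + (b + 1)) p).

Lemma smooth_DQ r a b : smooth (over V r) (@DQ r a b).
Proof.
apply: (smooth_comp (U' := over V (a + (b + 1)))) (smooth_map_jproj _ _) _.
- exact: open_over.
- by move=> p; rewrite /over /= base_jproj.
- exact: smooth_iterD.
Qed.

Lemma DQ_top r a b (p v : jet R r) : V (base p) -> jproj (a + b) v = 0 ->
  DQ a b (p + v) =
  DQ a b p - tau (base p) * ucoord v a.+1 b - xi (base p) * ucoord v a b.+1.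
Proof.
move=> Vp v0; rewrite /DQ jprojD top_affine_iterD ?base_jproj //.
  by rewrite !ucoord_jproj // addn1 !(addnS, addSn).
by rewrite jproj_jproj // addn1 addnS.
Qed.

(* Where tau vanishes, the D_x^b Q[u] are invariant under such translations. *)
Definition xnull n (v : jet R n) :=
  [/\ tcoord v = 0, xcoord v = 0 & forall b, ucoord v 0 b = 0].

Lemma xnullZ n k (v : jet R n) : xnull v -> xnull (k *: v).
Proof.
move=> [t0 x0 u0]; split=> [||c]; last by rewrite ucoordZ u0 mulr0.
  by rewrite -[LHS]/(k * tcoord v) t0 mulr0.
by rewrite -[LHS]/(k * xcoord v) x0 mulr0.
Qed.

Lemma xnull_mkjet n w : (forall c, w 0%N c = 0) -> xnull (mkjet n 0 0 w : jet R n).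
Proof.
move=> w0; split=> // c; have [cn|cn] := leqP (0 + c) n.
  by rewrite ucoord_mkjet.
by rewrite ucoord_out.
Qed.

Lemma xnull_jproj m n (v : jet R n) : xnull v -> xnull (jproj m v).
Proof. by case=> t0 x0 u0; rewrite jprojE t0 x0; exact: xnull_mkjet. Qed.

(** When tau = 0, Q[u] involves only t, x, u and u_x, and D_x introduces no t-derivatives. In the
    induction v enters D_x through the direction and through the point. *)
Lemma iterDx_xnull b p v : (forall q, V q -> tau q = 0) -> V (base p) ->
  xnull v -> iterDxQ b (p + v) = iterDxQ b p.
Proof.
move=> tau0; elim: b p v => [|b IH] p v Vp xv; have [t0 x0 u0] := xv;
    have bv : base (p + v) = base p by rewrite baseD /base t0 x0 u0 addr0.
  by rewrite /= /charac bv !ucoordD u0 addr0 tau0 // !mul0r.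
have dQ (q : jet R (b + 1).+1) : V (base q) ->
    differentiable (iterDxQ b) (jproj (b + 1) q).
  move=> Vq; apply: smooth_differentiable (@smooth_iterDx b) _.
  by rewrite /over /= base_jproj.
have dp := dQ p Vp; have dpv : differentiable (iterDxQ b) (jproj (b + 1) (p + v)).
  by apply: dQ; rewrite bv.
rewrite [LHS]Dx_tvec // [RHS]Dx_tvec //.
rewrite (tvecD 0 1 (p : jet R (b+1).+1) v) derive_dirD //.
(* The added direction [ushift 0 1 v] is again [xnull], so the function is constant along it by
   induction. *)
rewrite [X in _ + X](_ : _ = 0) ?addr0; last first.
  apply: (derive_affine (f := iterDxQ b)) => h; rewrite mulr0 addr0 [_ *: _ + _]addrC IH //.
    by rewrite base_jproj bv.
  by apply/xnullZ/xnull_mkjet => c; rewrite add0n u0.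
(* The directions now coincide and the two lines differ by the [xnull] vector [jproj (b + 1) v];
   induction applies while they stay over V. *)
rewrite jprojD; apply: (eq_derive_along (f := iterDxQ b) (g := iterDxQ b)).
have oU := @open_over V (b + 1) oV.
have Vq : over V (b + 1) (jproj (b + 1) p) by rewrite /over /= base_jproj.
have := near_line (tvec 0 1 (p : jet R (b + 1).+1)) oU Vq.
by apply: filterS => h Vh; rewrite addrA IH //; exact: xnull_jproj.
Qed.

Lemma DQ_xnull r b (p v : jet R r) : (forall q, V q -> tau q = 0) ->
  V (base p) -> xnull v -> DQ 0 b (p + v) = DQ 0 b p.
Proof.
move=> tau0 Vp xv; rewrite /DQ jprojD [LHS]iterDx_xnull ?base_jproj //.
exact: xnull_jproj.
Qed.

End Characteristic.

End TotalDerivatives.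
Arguments over {R} V n _.

(** * Retraction onto the manifold Q_(r) *)

Section Retraction.
Variables (R : realType) (V : set (R * R * R)) (tau xi eta : R * R * R -> R).
Hypotheses (oV : open V) (stau : smooth V tau) (sxi : smooth V xi)
  (seta : smooth V eta) (xi0 : forall q, V q -> xi q != 0).

(** Coordinate vector like [e_u], but indexed by plain naturals; it is 0 when a + b > n. *)
Definition uvec n a b : jet R n :=
  mkjet n 0 0 (fun a' b' => ((a' == a) && (b' == b))%:R).

Lemma ucoord_uvec n a b a' b' : (a + b <= n)%N ->
  ucoord (uvec n a b) a' b' = ((a' == a) && (b' == b))%:R.
Proof.
move=> abn; have [ab'|ab'] := leqP (a' + b') n; first exact: ucoord_mkjet.
rewrite ucoord_out //; case: eqP => //= ea; case: eqP => //= eb.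
by move: ab'; rewrite ea eb ltnNge abn.
Qed.

(* The equations D_t^a D_x^b Q[u] = 0 are ordered by a + b, then by b: the one of
   index (a, b) is affine in u_{a,b+1}, which no earlier one involves. *)
Definition solves r n b0 (rho : jet R r -> jet R r) :=
  smooth_map (over V r) rho /\
  forall p, V (base p) ->
  [/\ base (rho p) = base p,
      forall a, ucoord (rho p) a 0 = ucoord p a 0,
      Qmanifold tau xi eta p -> rho p = p &
      forall a b, (a + b < r)%N -> (a + b < n)%N || (a + b == n)%N && (b < b0)%N ->
        DQ tau xi eta a b (rho p) = 0].

(** The equation of index (n - b0, b0) has slope - xi in u_{n-b0,b0+1}, so adding its value divided
    by xi to that coordinate solves it exactly. The equations solved earlier do not involve this
    coordinate, and on Q_(r) the correction is 0. *)
Lemma solves_step r n b0 (rho : jet R r -> jet R r) :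
  (b0 <= n)%N -> (n < r)%N -> solves n b0 rho ->
  solves n b0.+1 (fun p => rho p +
    (DQ tau xi eta (n - b0)%N b0 (rho p) * (xi (base p))^-1) *: uvec r (n - b0)%N b0.+1).
Proof.
move=> b0n nr [srho rhoP]; have oU := @open_over R V r oV.
set v := uvec r (n - b0)%N b0.+1.
have vn : (n - b0 + b0.+1 = n.+1)%N by rewrite addnS subnK.
have uv a b : ucoord v a b = ((a == n - b0)%N && (b == b0.+1))%:R.
  by rewrite ucoord_uvec // vn.
have v0 : jproj n v = 0.
  apply: jproj_eq0 => // a b abn; rewrite uv; case: eqP => //= ea; case: eqP => //= eb.
  by move: abn; rewrite ea eb vn ltnn.
split.
  apply: smooth_mapDZ => //; apply: smoothM => //.
    apply: (smooth_comp (U' := over V r)) srho _ => //.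
      by move=> p Vp; rewrite /over /=; have [-> _ _ _] := rhoP p Vp.
    exact: smooth_DQ.
  apply: smoothV => //; first by move=> p; exact: xi0.
  exact: smooth_over.
move=> p Vp; have [rb ru rQ rD] := rhoP p Vp.
set k := _ * _.
have bv : base (rho p + k *: v) = base p.
  rewrite baseD baseZ rb -[RHS]addr0; congr (_ + _).
  by rewrite /base uv andbF /tcoord /xcoord; apply/pair_equal_spec; split;
    rewrite /= ?scaler0 //; rewrite /GRing.scale /= !mulr0.
split=> //.
- by move=> a; rewrite ucoordD ucoordZ uv andbF mulr0 addr0.
- move=> Qp; rewrite rQ // /k rQ // [DQ _ _ _ _ _ _]Qp ?mul0r ?scale0r ?addr0 //.
  by rewrite subnK.
move=> a b abr abn.
have ab_n : (a + b <= n)%N by case/orP: abn => [/ltnW//|/andP[/eqP-> //]].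
rewrite (DQ_top oV stau sxi seta) //; first last.
- by rewrite jprojZ -(jproj_jproj v ab_n) v0 jproj0 scaler0.
- by rewrite rb.
rewrite !ucoordZ !uv eqSS.
have [/andP[/eqP ea /eqP eb]|nab] := boolP ((a == n - b0)%N && (b == b0)).
  rewrite ea eb (gtn_eqF (ltnSn _)) /= !mulr0 subr0 mulr1 /k rb.
  by rewrite mulrCA divff ?mulr1 ?subrr // xi0.
(* The coordinate u_{a+1,b} is the corrected one only if b = b0 + 1, that is, for an equation later
   in the order. *)
have -> : ((a.+1 == n - b0)%N && (b == b0.+1)) = false.
  apply/negP => /andP[/eqP ea /eqP eb]; case/orP: abn => [abn|/andP[/eqP abn]].
    by move: abn; rewrite eb addnS -addSn ea subnK // ltnn.
  by rewrite eb ltnn.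
rewrite /= !mulr0 !subr0 rD //.
case/orP: abn => [->//|/andP[/eqP abn]].
rewrite ltnS leq_eqVlt abn eqxx ltnn /= => /orP[/eqP eb|//].
by move: nab; rewrite -abn eb addnK !eqxx.
Qed.

Lemma solves_ex r n b0 : (n < r)%N -> (b0 <= n.+1)%N ->
  exists rho : jet R r -> jet R r, solves n b0 rho.
Proof.
elim: n b0 => [|n IHn] b0 nr.
- elim: b0 => [|b0 IHb] b0n.
    exists id; split=> [|p Vp]; first exact: smooth_map_id.
    by split=> // a b _; rewrite ltn0 andbF.
  have [rho srho] := IHb (ltnW b0n).
  by eexists; apply: solves_step srho.
- elim: b0 => [|b0 IHb] b0n.
    (* An index with a + b = n has b <= n, so [solves n n.+1] already gives [solves n.+1 0]. *)
    have [rho [srho rhoP]] := IHn n.+1 (ltnW nr) (leqnn _).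
    exists rho; split=> // p Vp; have [rb ru rQ rD] := rhoP p Vp.
    split=> // a b abr; rewrite andbF orbF ltnS leq_eqVlt => abn; apply: rD => //.
    case/orP: abn => [/eqP abn|->//].
    by rewrite -abn eqxx ltnS leq_addl orbT.
  have [rho srho] := IHb (ltnW b0n).
  by eexists; apply: solves_step srho.
Qed.

Lemma retraction r : (0 < r)%N -> exists rho : jet R r -> jet R r,
  smooth_map (over V r) rho /\
  forall p, V (base p) ->
  [/\ base (rho p) = base p,
      forall a, ucoord (rho p) a 0 = ucoord p a 0,
      Qmanifold tau xi eta p -> rho p = p & Qmanifold tau xi eta (rho p)].
Proof.
case: r => // r _.
have [rho [srho rhoP]] := @solves_ex r.+1 r r.+1 (leqnn _) (leqnn _).
exists rho; split=> // p Vp; have [rb ru rQ rD] := rhoP p Vp.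
split=> // a b abr; apply: rD => //.
move: abr; rewrite ltnS leq_eqVlt orbC => /orP[->//|/eqP abr].
by rewrite abr eqxx ltnS -abr leq_addl orbT.
Qed.

Lemma DQ_jproj m r a b (p : jet R r) : (a + b < m)%N ->
  DQ tau xi eta a b (jproj m p) = DQ tau xi eta a b p.
Proof. by move=> abm; rewrite /DQ jproj_jproj // addn1 addnS. Qed.

(** For tau = 0 the equation D_x^b Q[u] = 0 determines u_{0,b+1} from t, x and the lower u_{0,k},
    since its coefficient - xi is nonzero. *)
Lemma Qmanifold_ucoord0 r (p p' : jet R r) : (forall q, V q -> tau q = 0) ->
  V (base p) -> base p = base p' ->
  Qmanifold tau xi eta p -> Qmanifold tau xi eta p' ->
  forall b, ucoord p 0 b = ucoord p' 0 b.
Proof.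
move=> tau0 Vp bp Qp Qp' b; have [br|rb] := leqP b r; last by rewrite !ucoord_out.
elim/ltn_ind: b br => -[|b] IH br; first by case: bp.
(* In J^(b+1) the difference q' - q splits into its u_{0,b+1} component v and a remainder, which is
   [xnull] by the induction hypothesis. *)
pose q := jproj b.+1 p; pose q' := jproj b.+1 p'.
pose c := ucoord q' 0 b.+1 - ucoord q 0 b.+1.
pose v := c *: uvec b.+1 0 b.+1.
have Vq : V (base q) by rewrite base_jproj.
have uv a' b' : ucoord v a' b' = c * ((a' == 0%N) && (b' == b.+1))%:R.
  by rewrite ucoordZ ucoord_uvec.
have tv : tcoord v = 0 by rewrite -[LHS]/(c * 0) mulr0.
have xv : xcoord v = 0 by rewrite -[LHS]/(c * 0) mulr0.
have v0 : jproj (0 + b) v = 0.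
  apply: jproj_eq0 => // a' b' ab; rewrite uv.
  case: eqP => [ea|]; rewrite ?mulr0 //=; case: eqP => [eb|]; rewrite ?mulr0 //.
  by move: ab; rewrite ea eb !add0n ltnn.
have bqv : base (q + v) = base q.
  by rewrite baseD /base tv xv uv andbF mulr0 addr0.
have xn : xnull (q' - q - v).
  split=> [||j].
  - rewrite -[LHS]/(tcoord q' - tcoord q - tcoord v) tv subr0.
    by case: bp; rewrite /q' /q => e _ _; rewrite -[LHS]/(tcoord p' - tcoord p) e subrr.
  - rewrite -[LHS]/(xcoord q' - xcoord q - xcoord v) xv subr0.
    by case: bp; rewrite /q' /q => _ e _; rewrite -[LHS]/(xcoord p' - xcoord p) e subrr.
  rewrite !ucoordD !ucoordN uv eqxx /=.
  have [->|jb] := eqVneq j b.+1; first by rewrite mulr1 subrr.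
  rewrite mulr0 subr0; have [jb'|bj] := leqP j b.+1; last by rewrite !ucoord_out ?subrr.
  rewrite !ucoord_jproj // IH ?subrr //; first by rewrite ltn_neqAle jb.
  exact: leq_trans br.
have : DQ tau xi eta 0 b (q + v + (q' - q - v)) = 0.
  by rewrite -[q' - q - v]addrA -opprD [q + v + _]addrC subrK DQ_jproj // [LHS]Qp'.
(* The remainder contributes nothing and v contributes - xi c; as the function vanishes at q and q',
   c = 0. *)
rewrite (DQ_xnull oV stau sxi seta) ?bqv // (DQ_top oV stau sxi seta) // !uv tau0 //.
rewrite mul0r subr0 !eqxx /= mulr1 DQ_jproj // [DQ _ _ _ _ _ _]Qp // sub0r => /eqP.
rewrite oppr_eq0 mulf_eq0 (negbTE (xi0 Vq)) /= subr_eq0 => /eqP e.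
by move: e; rewrite !ucoord_jproj.
Qed.

End Retraction.

(** * Order and singularity *)

Section Order.
Variable R : realType.

Lemma order_derive n (W : set (jet R n)) (f : jet R n -> R) k p c : open W ->
  Defs.order W f < k%:Z -> W p -> (k <= deg_t c + deg_x c)%N -> 'D_(e_u R c) f p = 0.
Proof.
(* The zero function has order -1, below every k, so it is treated apart: its derivatives vanish on
   the open set W. *)
move=> oW; rewrite /Defs.order; case: asboolP => [f0 _ Wp _|_ fk Wp kc].
  rewrite (eq_derive_open (g := fun=> 0) _ oW Wp) ?derive_cst //.
  by move=> q /set_mem; exact: f0.
apply/eqP; apply: contraTT kc => Df; rewrite -ltnNge.
rewrite ltz_nat in fk; apply: leq_ltn_trans fk.
by apply: (leq_bigmax_cond (F := fun c => deg_t c + deg_x c)%N); apply/asboolP; exists p.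
Qed.

(** In the coordinate expansion of v, the terms of order below k vanish by the choice of v, the
    others by the order of f. *)
Lemma order_derive_eq0 n (W : set (jet R n)) (f : jet R n -> R) k p v : open W ->
  smooth W f -> Defs.order W f < k%:Z -> W p -> tcoord v = 0 -> xcoord v = 0 ->
  (forall a b, (a + b < k)%N -> ucoord v a b = 0) -> 'D_v f p = 0.
Proof.
move=> oW sf fk Wp t0 x0 u0; have df := smooth_differentiable sf Wp.
rewrite [v]jet_decomp t0 x0 !scale0r !add0r derive_dir_sum // big1 // => c _.
rewrite derive_dirZ //; have [ck|kc] := ltnP (deg_t c + deg_x c) k.
  by rewrite u0 // mul0r.
by rewrite (order_derive oW fk Wp kc) mulr0.
Qed.

Lemma ucoord_e_u n (c : mindex n) a b :
  ucoord (e_u R c) a b = ((deg_t c == a) && (deg_x c == b))%:R.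
Proof.
have [abn|nab] := leqP (a + b) n; last first.
  rewrite ucoord_out //; case: eqP => //= ea; case: eqP => //= eb.
  by move: (mindex_deg c); rewrite ea eb leqNgt nab.
rewrite (ucoord_mindex_of _ abn) /= mxE eqxx /= (inj_eq enum_rank_inj).
move: (mindex_of abn) (deg_t_mindex_of abn) (deg_x_mindex_of abn) => c' <- <-.
by rewrite eq_sym.
Qed.

(** The derivative 1 along u_t, a coordinate since n > 0, excludes the zero function and bounds the
    order from below; derivatives along coordinates of order at least 2 vanish. *)
Lemma order_eq1 n (W : set (jet R n)) (f : jet R n -> R) p0 : (0 < n)%N ->
  open W -> W p0 ->
  (forall p c, W p -> (0 < deg_t c + deg_x c)%N ->
    'D_(e_u R c) f p = ucoord (e_u R c) 1 0) ->
  Defs.order W f = 1.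
Proof.
move=> n0 oW Wp0 Df.
pose c1 := @mindex_of n 1 0 n0.
have t1 : deg_t c1 = 1%N by exact: deg_t_mindex_of.
have x1 : deg_x c1 = 0%N by exact: deg_x_mindex_of.
have D1 : 'D_(e_u R c1) f p0 = 1 by rewrite Df // ?ucoord_e_u t1 x1.
rewrite /Defs.order; case: asboolP => [f0|_].
  have := oner_neq0 R; rewrite -D1 (eq_derive_open (g := fun=> 0) _ oW Wp0).
    by rewrite derive_cst eqxx.
  by move=> q /set_mem; exact: f0.
congr Posz; apply/eqP; rewrite eqn_leq; apply/andP; split.
  apply/bigmax_leqP => c /asboolP[p Wp]; have [//|c2] := leqP.
  rewrite Df ?(ltn_trans _ c2) // ucoord_e_u.
  case: (deg_t c =P 1%N) => [tc|_]; last by rewrite eqxx.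
  case: (deg_x c =P 0%N) => [xc|_]; last by rewrite eqxx.
  by move: c2; rewrite tc xc.
rewrite -[X in (X <= _)%N](_ : deg_t c1 + deg_x c1 = 1)%N; last by rewrite t1 x1.
apply: (leq_bigmax_cond (F := fun c => deg_t c + deg_x c)%N).
by apply/asboolP; exists p0; rewrite ?D1 ?oner_neq0.
Qed.

End Order.

(** * Singular vector fields of evolution equations *)

Section Evolution.
Variable R : realType.

Lemma xjetDZ n h (p v : jet R n) : xjet (h *: v + p) = h *: xjet v + xjet p.
Proof.
by congr (_, _, _); apply/rowP => k; rewrite !mxE ucoordD ucoordZ.
Qed.

Lemma open_smooth_preimage (X Y : normedModType R) (U : set X) (O : set Y)
    (phi : X -> Y) :
  open U -> open O -> smooth_map U phi -> open (U `&` phi @^-1` O).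
Proof.
move=> oU oO sphi; rewrite openE => p [Up Op]; apply: filterI.
  exact: open_nbhs_nbhs.
apply: (smooth_map_continuous sphi Up); exact: open_nbhs_nbhs.
Qed.

Lemma open_xjet n (D : set (R * R * 'rV[R]_n.+1)) : open D ->
  open [set p : jet R n | D (xjet p)].
Proof.
move=> oD; have := open_smooth_preimage openT oD (@smooth_map_xjet R n setT).
by rewrite setTI.
Qed.

Lemma smooth_xjet n (D : set (R * R * 'rV[R]_n.+1)) H : open D -> smooth D H ->
  smooth [set p : jet R n | D (xjet p)] (fun p => H (xjet p)).
Proof.
move=> oD sH; apply: smooth_comp sH => //; first exact: open_xjet.
exact: smooth_map_xjet.
Qed.

Lemma derive_evol n (D : set (R * R * 'rV[R]_n.+1)) H (p v : jet R n) :
  open D -> smooth D H -> D (xjet p) ->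
  'D_v (evol H) p = ucoord v 1 0 - 'D_(xjet v) H (xjet p).
Proof.
move=> oD sH Dp.
have dH : derivable (fun q : jet R n => H (xjet q)) p v.
  by apply: diff_derivable; exact: smooth_differentiable (smooth_xjet oD sH) Dp.
have du : derivable (fun q : jet R n => ucoord q 1 0) p v.
  apply: diff_derivable.
  exact: smooth_differentiable (smooth_ucoord (U := setT) 1 0) I.
rewrite [LHS](deriveB du dH); congr (_ - _).
  by apply: derive_linear; exact: ucoord_linear.
by apply: eq_derive_along; near=> h; rewrite xjetDZ.
Unshelve. all: by end_near. Qed.

(** A smooth section of [base] that keeps the derivatives of p of positive order; it passes through
    p. *)
Definition rebase r (p : jet R r) (q : R * R * R) : jet R r :=
  mkjet r q.1.1 q.1.2
    (fun a b => if (a == 0)%N && (b == 0)%N then q.2 else ucoord p a b).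

Lemma base_rebase r (p : jet R r) q : base (rebase p q) = q.
Proof. by case: q => [[t x] u]; rewrite /base ucoord_mkjet. Qed.

Lemma rebase_base r (p : jet R r) : rebase p (base p) = p.
Proof.
apply: jet_ext => // a b ab; rewrite ucoord_mkjet //.
by case: eqP => //= ->; case: eqP => //= ->.
Qed.

Lemma smooth_map_rebase r (p : jet R r) U : smooth_map U (rebase p).
Proof.
have s1 : smooth U (fun q : R * R * R => q.1.1).
  apply: smooth_linear => [k ? ? //|q].
  apply: (differentiable_comp (f := fst) (g := fst));
    apply: linear_differentiable => ?; exact: cvg_fst.
have s2 : smooth U (fun q : R * R * R => q.1.2).
  apply: smooth_linear => [k ? ? //|q].
  apply: (differentiable_comp (f := fst) (g := snd));
    apply: linear_differentiable => ?; [exact: cvg_fst|exact: cvg_snd].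
have s3 : smooth U (fun q : R * R * R => q.2).
  apply: smooth_linear => [k ? ? //|q].
  apply: linear_differentiable => ?; exact: cvg_snd.
apply: smooth_map_jet => // a b.
have [ab|ab] := leqP (a + b) r; last first.
  by under eq_fun do rewrite ucoord_out //; exact: smooth_cst.
under eq_fun do rewrite ucoord_mkjet //.
by case: (_ && _) => //; exact: smooth_cst.
Qed.

Section Fields.
Variables (r : nat) (D : set (R * R * 'rV[R]_r.+1)) (H : R * R * 'rV[R]_r.+1 -> R)
  (V : set (R * R * R)) (tau xi eta : R * R * R -> R).
Hypotheses (r1 : (1 < r)%N) (oD : open D) (sH : smooth D H) (oV : open V)
  (stau : smooth V tau) (sxi : smooth V xi) (seta : smooth V eta).

(* If tau(base p1) <> 0, moving p1 along v, which changes only the derivatives of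
   order r, stays in Q_(r); L' is then constant to first order, while the
   derivative of H along xjet v is H_{u_r}. *)
Lemma lower_rep_tau_eq0 W L' p1 :
  (forall q, D q -> 'D_(e_ur R r) H q != 0) ->
  open W -> smooth W L' -> Defs.order W L' < r%:Z ->
  (forall p, W p -> Qmanifold tau xi eta p -> evol H p = L' p) ->
  W p1 -> Qmanifold tau xi eta p1 -> V (base p1) -> D (xjet p1) ->
  tau (base p1) = 0.
Proof.
move=> Hr oW sL' oL' LL' Wp1 Qp1 Vp1 Dp1; apply/eqP/negPn/negP => tau1.
(* The root of tau m + xi = 0 at [base p1], so that tau v_{a+1,b} + xi v_{a,b+1} = 0 whenever a + b
   + 1 = r. *)
pose m := - (xi (base p1) / tau (base p1)).
pose v := mkjet r 0 0 (fun a b => if (a + b == r)%N then m ^+ a else 0).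
have v_lt a b : (a + b < r)%N -> ucoord v a b = 0.
  by move=> ab; rewrite ucoord_mkjet ?ltn_eqF // ltnW.
have v_r a b : (a + b = r)%N -> ucoord v a b = m ^+ a.
  by move=> ab; rewrite ucoord_mkjet ab ?eqxx.
have Qv h : Qmanifold tau xi eta (h *: v + p1).
  move=> a b ab; rewrite -/(DQ tau xi eta a b _) addrC.
  rewrite (DQ_top oV stau sxi seta) //; last first.
    rewrite jprojZ jproj_eq0 ?scaler0 // => a' b' ab'.
    by apply: v_lt; exact: leq_ltn_trans ab.
  rewrite [DQ _ _ _ _ _ _]Qp1 // sub0r !ucoordZ.
  have [abr|abr] := eqVneq (a + b).+1 r; last first.
    have abr' : ((a + b).+1 < r)%N by rewrite ltn_neqAle abr.
    by rewrite !v_lt ?addnS ?addSn // !mulr0 oppr0 addr0.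
  rewrite !v_r ?addnS ?addSn // exprS (mulrCA h m) (mulrA (tau _)).
  rewrite (_ : tau (base p1) * m = - xi (base p1)); last by rewrite mulrN mulrCA divff ?mulr1.
  by rewrite mulNr opprK subrr.
have : 'D_v L' p1 = 'D_v (evol H) p1.
  apply: eq_derive_along; have := near_line v oW Wp1.
  by apply: filterS => h Wh; rewrite LL'.
(* Since v has components of order r only, L' has derivative 0 along it; the u_t component is 0
   because 1 < r. *)
rewrite (order_derive_eq0 oW sL' oL') // (derive_evol _ oD sH) // v_lt ?addn0 // sub0r.
have -> : xjet v = e_ur R r.
  congr (_, _, _); apply/rowP => k; rewrite !mxE eqxx /=.
  have [->|kr] := eqVneq k ord_max; first by rewrite v_r.
  rewrite v_lt // add0n ltn_neqAle -ltnS ltn_ord andbT.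
  by apply: contra kr => /eqP kr; apply/eqP/val_inj.
by move=> /eqP; rewrite eq_sym oppr_eq0 (negbTE (Hr _ Dp1)).
Qed.

Lemma singular_tau_eq0 (p0 : jet R r) :
  (forall q, D q -> 'D_(e_ur R r) H q != 0) ->
  (forall q, V q -> (tau q, xi q) <> (0, 0)) ->
  D (xjet p0) -> V (base p0) -> Qmanifold tau xi eta p0 ->
  singular_at tau xi eta (evol H) p0 -> \forall q \near base p0, tau q = 0.
Proof.
move=> Hr txi Dp0 Vp0 Qp0 [W [L' [[oW Wp0] sL' oL' LL']]].
have key := lower_rep_tau_eq0 Hr oW sL' oL' LL'.
have tau0 := key _ Wp0 Qp0 Vp0 Dp0.
have xi0 : xi (base p0) != 0.
  by apply/eqP => xi0; apply: (txi _ Vp0); rewrite tau0 xi0.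
(* The retraction needs xi nonzero on its whole domain, so V is shrunk around the base point. *)
pose V1 := V `&` xi @^-1` [set y | y != 0].
have oV1 : open V1.
  rewrite openE => q [Vq xq]; apply: filterI; first exact: open_nbhs_nbhs.
  have cxi : {for q, continuous xi}.
    by apply: differentiable_continuous; exact: smooth_differentiable sxi Vq.
  by apply: cxi; apply: open_nbhs_nbhs; split=> //; exact: open_neq.
have V1V : V1 `<=` V by move=> q [].
have [rho [srho rhoP]] := retraction oV1 (smooth_subset V1V stau)
  (smooth_subset V1V sxi) (smooth_subset V1V seta) (fun q (V1q : V1 q) => V1q.2)
  (ltnW r1).
have V1p0 : V1 (base p0) by split.
have rp0 : rho p0 = p0 by have [_ _ rQ _] := rhoP p0 V1p0; exact: rQ.
have oWD : open (W `&` [set p | D (xjet p)]) by apply: openI => //; exact: open_xjet.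
have n1 : \forall p \near p0, (W `&` [set p | D (xjet p)]) (rho p).
  have /smooth_map_continuous/(_ V1p0) c := srho.
  by apply: c; rewrite rp0; exact: open_nbhs_nbhs.
(* The continuous map sending q to [rho (rebase p0 q)] takes [base p0] to p0 and has values in Q_(r)
   over q. Near [base p0] it lands where [key] applies. *)
have n2 : \forall q \near base p0, (W `&` [set p | D (xjet p)]) (rho (rebase p0 q)).
  have c := smooth_map_continuous (smooth_map_rebase p0 setT) (I : setT (base p0)).
  rewrite -{1}(rebase_base p0) in n1.
  exact: (c _ n1).
have n3 : \forall q \near base p0, V1 q by exact: open_nbhs_nbhs.
apply: filterS2 n2 n3 => q [Wq Dq] V1q.
have V1b : V1 (base (rebase p0 q)) by rewrite base_rebase.
have [rb _ _ rQ] := rhoP _ V1b.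
by have := key _ Wq rQ; rewrite rb base_rebase; apply=> //; exact: V1V.
Qed.

Lemma coorder1 (p0 : jet R r) :
  (forall q, V q -> xi q != 0) -> (forall q, V q -> tau q = 0) ->
  D (xjet p0) -> V (base p0) -> Qmanifold tau xi eta p0 ->
  coorder_at tau xi eta (evol H) p0 1.
Proof.
move=> xi0 tau0 Dp0 Vp0 Qp0.
have r0 := ltnW r1.
have [rho [srho rhoP]] := retraction oV stau sxi seta xi0 r0.
have xjetQ p p' : V (base p) -> base p = base p' -> Qmanifold tau xi eta p ->
    Qmanifold tau xi eta p' -> xjet p = xjet p'.
  move=> Vp bp Qp Qp'; have [bt bx _] := bp.
  congr (_, _, _) => //; apply/rowP => k; rewrite !mxE.
  exact: (Qmanifold_ucoord0 oV stau sxi seta xi0 tau0 Vp bp Qp Qp').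
split.
(* A smooth section of Q_(r) over V. The choice of the jet 0 is harmless: by [xjetQ] only the base
   point matters for [xjet]. *)
- pose sec q := rho (rebase 0 q).
  have secP q : V q -> base (sec q) = q /\ Qmanifold tau xi eta (sec q).
    move=> Vq; have Vb : V (base (rebase (0 : jet R r) q)) by rewrite base_rebase.
    by have [rb _ _ rQ] := rhoP _ Vb; rewrite /sec rb base_rebase.
  have xjet_sec p : V (base p) -> Qmanifold tau xi eta p ->
      xjet (sec (base p)) = xjet p.
    by move=> Vp Qp; have [sb sQ] := secP _ Vp; apply: xjetQ; rewrite ?sb.
  (* H is controlled on D only, so q is restricted to the open set where [xjet (sec q)] lies in
     D. *)
  pose U := over V r `&` rho @^-1` [set p | D (xjet p)].
  have oU : open U.
    by apply: open_smooth_preimage => //; [exact: open_over|exact: open_xjet].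
  pose W0 := setT `&` @rebase r 0 @^-1` U.
  have oW0 : open W0.
    apply: open_smooth_preimage => //; [exact: openT|exact: smooth_map_rebase].
  have W0E q : W0 q -> V q by case=> _ [] ; rewrite /over /= base_rebase.
  have sg : smooth W0 (fun q => H (xjet (sec q))).
    apply: (smooth_comp (U' := U) (phi := rebase 0) (g := fun p => H (xjet (rho p)))) => //.
    + by move=> q [].
    + exact: smooth_map_rebase.
    apply: (smooth_comp (U' := [set p | D (xjet p)]) (phi := rho) (g := fun p => H (xjet p))) => //.
    + by move=> q [].
    + by apply: smooth_map_subset srho => q [].
    exact: smooth_xjet.
  pose W := over W0 r.
  have oW : open W by exact: open_over.
  have Wp0 : W p0.
    split=> //; split; first by rewrite /over /= base_rebase.
    by rewrite /= -/(sec (base p0)) xjet_sec.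
  pose L' (p : jet R r) := ucoord p 1 0 - H (xjet (sec (base p))).
  have oL' : Defs.order W L' = 1.
    apply: order_eq1 Wp0 _ => // p c Wp c0.
    apply: derive_affine => h; rewrite /L' baseD baseZ.
    have -> : base (e_u R c) = 0.
      rewrite /base ucoord_e_u; case: eqP => [ea|] //=; case: eqP => [eb|] //=.
      by move: c0; rewrite ea eb.
    by rewrite scaler0 add0r ucoordD ucoordZ [h * _ + _]addrC addrAC.
  exists W, L'; split=> //; split=> //.
  + apply: smoothB => //; first exact: smooth_ucoord.
    exact: (smooth_over (V := W0) (f := fun q => H (xjet (sec q)))).
  + by rewrite oL'.
  by move=> p Wp Qp; rewrite /L' /evol xjet_sec //; exact: W0E.
move=> W L' [[oW Wp0] sL' _ LL']; rewrite leNgt; apply/negP => oL'.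
pose e := uvec R r 1 0.
have ue a b : ucoord e a b = ((a == 1%N) && (b == 0%N))%:R by rewrite ucoord_uvec.
have be h : base (h *: e + p0) = base p0.
  rewrite baseD baseZ; suff -> : base e = 0 by rewrite scaler0 add0r.
  by rewrite /base ue.
have Veh h : V (base (h *: e + p0)) by rewrite be.
have rp0 : rho p0 = p0 by have [_ _ rQ _] := rhoP p0 Vp0; exact: rQ.
have drho : differentiable rho p0 by exact: smooth_map_differentiable srho _.
pose w := 'D_e rho p0.
(* A linear function that is constant along the curve vanishes on its velocity w. Applied to t, x
   and u, this leaves w with components of positive order only, which a function of order at most 0
   does not see. *)
have wl (l : jet R r -> R) : linear l -> (forall p, differentiable l p) ->
    (forall h, l (rho (h *: e + p0)) = l p0) -> l w = 0.
  move=> ll dl lh; rewrite -(derive_linear w (rho p0) ll) -derive_comp //.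
  by apply: derive_affine => h; rewrite mulr0 addr0 /= lh rp0.
have sT (l : jet R r -> R) : smooth setT l -> forall p, differentiable l p.
  by move=> sl p; exact: smooth_differentiable sl I.
(* The curve lies in Q_(r) over one base point, so [xjet] is constant on it, while rho preserves
   u_t: hence L, and with it L', is h plus a constant. *)
have Lrho : 'D_e (L' \o rho) p0 = 1.
  have <- : 'D_1 (fun h : R => h + evol H p0) 0 = 1.
    by apply: derive_affine => h; rewrite add0r mulr1 addrC -[h *: 1]/(h * 1) mulr1 addr0.
  apply: eq_derive_along.
  have nW : \forall h \near (0 : R), W (rho (h *: e + p0)).
    have oP : open (over V r `&` rho @^-1` W).
      by apply: open_smooth_preimage => //; exact: open_over.
    have := near_line e oP (conj Vp0 _ : (over V r `&` rho @^-1` W) p0).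
    rewrite /= rp0 => /(_ Wp0); by apply: filterS => h [].
  apply: filterS nW => h Wh /=; have [rb ru _ rQ] := rhoP _ (Veh h).
  rewrite -LL' // /evol ru ucoordD ucoordZ ue mulr1 addr0 -[h *: 1]/(h * 1) mulr1 addrA.
  by rewrite (xjetQ _ _ p0) // rb ?be.
have := oner_neq0 R; rewrite -Lrho derive_comp //; last first.
  by rewrite rp0; exact: smooth_differentiable sL' _.
rewrite rp0 (order_derive_eq0 oW sL' oL') ?eqxx //.
- apply: (wl (@tcoord R r)) => //; first exact/sT/smooth_tcoord.
  by move=> h; have [[-> _ _] _ _ _] := rhoP _ (Veh h); case: (be h).
- apply: (wl (@xcoord R r)) => //; first exact/sT/smooth_xcoord.
  by move=> h; have [[_ -> _] _ _ _] := rhoP _ (Veh h); case: (be h).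
move=> a b; rewrite ltnS leqn0 addn_eq0 => /andP[/eqP-> /eqP->].
apply: (wl (fun p => ucoord p 0 0)); first exact: ucoord_linear.
  exact/sT/smooth_ucoord.
by move=> h; have [[_ _ ->] _ _ _] := rhoP _ (Veh h); case: (be h).
Qed.

End Fields.
End Evolution.

Theorem proposition2 (R : realType) (r : nat)
    (D : set (R * R * 'rV[R]_r.+1)) (H : R * R * 'rV[R]_r.+1 -> R)
    (V : set (R * R * R)) (tau xi eta : R * R * R -> R) (p0 : jet R r) :
  (1 < r)%N ->
  open D -> smooth D H ->
  (forall q, D q -> 'D_(e_ur R r) H q != 0) ->
  open V -> smooth V tau -> smooth V xi -> smooth V eta ->
  (forall q, V q -> (tau q, xi q) <> (0, 0)) ->
  D (xjet p0) -> V (base p0) -> Qmanifold tau xi eta p0 ->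
  (singular_at tau xi eta (evol H) p0 <->
     \forall q \near base p0, tau q = 0) /\
  (singular_at tau xi eta (evol H) p0 ->
     coorder_at tau xi eta (evol H) p0 1).
Proof.
move=> r1 oD sH Hr oV stau sxi seta txi Dp0 Vp0 Qp0.
have sing_tau := singular_tau_eq0 r1 oD sH oV stau sxi seta Hr txi Dp0 Vp0 Qp0.
have tau_coorder : (\forall q \near base p0, tau q = 0) ->
    coorder_at tau xi eta (evol H) p0 1.
  (* The claim concerns germs, so V may be replaced by its intersection with a neighbourhood where
     tau = 0; there xi cannot vanish. *)
  rewrite /prop_near1 nbhsE => -[U [oU Up0] Utau].
  have UVV : V `&` U `<=` V by move=> q [].
  have tau0 q : (V `&` U) q -> tau q = 0 by case=> _ /Utau.
  have xi0 q : (V `&` U) q -> xi q != 0.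
    move=> VUq; apply/eqP => xiq; apply: (txi q (UVV q VUq)).
    by rewrite xiq tau0.
  exact: (coorder1 r1 oD sH (openI oV oU) (smooth_subset UVV stau)
    (smooth_subset UVV sxi) (smooth_subset UVV seta)).
split; last by move=> /sing_tau.
split=> // /tau_coorder[[W [L' [LL' _]]] _].
by exists W, L'.
Qed.
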